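(* (a) Let $M$ be a smooth $3$-manifold and let $\omega=(\omega^1,\omega^2,\omega^3)$ be a smooth coframing on $M$ such that $\mathrm{d}\omega^2=\mathrm{d}\omega^3=0$ and such that the Riemannian metric $g=(\omega^1)^2+(\omega^2)^2+(\omega^3)^2$ is flat. Then $\omega^1\wedge\mathrm{d}\omega^1=0$. (b) On $\mathbb{R}^3$ with coordinates $(u^1,u^2,u^3)$, let $\Omega=(\Omega^1,\Omega^2,\Omega^3)=(\Upsilon,0,0)$, where $$\Upsilon=u^1\,\mathrm{d}u^2\wedge\mathrm{d}u^3+u^2\,\mathrm{d}u^3\wedge\mathrm{d}u^1-2u^3\,\mathrm{d}u^1\wedge\mathrm{d}u^2 .$$ Then there is no smooth coframing $\omega=(\omega^1,\omega^2,\omega^3)$ on any open neighborhood of $u=(0,0,0)$ such that $\mathrm{d}\omega^i=\Omega^i$ for $i=1,2,3$ and the metric $g=(\omega^1)^2+(\omega^2)^2+(\omega^3)^2$ is flat.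
   Context: A coframing on a $3$-manifold is a triple of $1$-forms that are linearly independent at every point. *)

(* Defs.v *)
From HB Require Import structures.
From mathcomp Require Import all_boot all_order all_algebra.
From mathcomp Require Import all_classical all_reals all_analysis.
Set Implicit Arguments.
Unset Strict Implicit.
Unset Printing Implicit Defensive.
Import Order.TTheory GRing.Theory Num.Theory.
Import numFieldNormedType.Exports.
Local Open Scope classical_set_scope.
Local Open Scope ring_scope.

(* R^n is 'rV[R]_n, and coordinates are numbered from 0: the coordinate x^i
   with 1 <= i <= n is x 0 (i - 1). *)

Definition partial (R : realType) (n : nat) (i : 'I_n)
    (f : 'rV[R]_n -> R) : 'rV[R]_n -> R :=
  fun x => 'D_(delta_mx 0 i) f x.

(* On an open set U, [partial i f] at a point of U depends only on the values
   of f on U. *)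
Fixpoint class_C (R : realType) (n : nat) (k : nat) (U : set 'rV[R]_n)
    (f : 'rV[R]_n -> R) : Prop :=
  (forall x, U x -> {for x, continuous f}) /\
  (if k is k'.+1 then
     forall i : 'I_n,
       (forall x, U x -> derivable f x (delta_mx 0 i)) /\
       class_C k' U (partial i f)
   else True).

Definition smooth_on (R : realType) (n : nat) (U : set 'rV[R]_n)
    (f : 'rV[R]_n -> R) : Prop :=
  forall k, class_C k U f.

Definition smooth_map_on (R : realType) (n m : nat) (U : set 'rV[R]_n)
    (f : 'rV[R]_n -> 'rV[R]_m) : Prop :=
  forall j : 'I_m, smooth_on U (fun x => f x 0 j).

(* The k-forms on R^n used below are given by components:
   - a 1-form by the row of its coefficients, sum_i a_i dx^i;
   - a 2-form by an antisymmetric matrix, sum_(i < j) b_ij dx^i /\ dx^j;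
   - a 3-form by c_ijk, with sum_(i < j < k) c_ijk dx^i /\ dx^j /\ dx^k.
   No factorials enter, so that dx^1 /\ ... /\ dx^k has (1, ..., k)
   component 1. *)

Definition wedge11 (R : realType) (n : nat) (a b : 'rV[R]_n) : 'M[R]_n :=
  \matrix_(i, j) (a 0 i * b 0 j - a 0 j * b 0 i).

Definition wedge12 (R : realType) (n : nat) (a : 'rV[R]_n) (b : 'M[R]_n)
    (i j k : 'I_n) : R :=
  a 0 i * b j k + a 0 j * b k i + a 0 k * b i j.

Definition extd (R : realType) (n : nat) (w : 'rV[R]_n -> 'rV[R]_n)
    (x : 'rV[R]_n) : 'M[R]_n :=
  \matrix_(i, j) (partial i (fun y => w y 0 j) x
                  - partial j (fun y => w y 0 i) x).

Definition coframing_on (R : realType) (n : nat) (U : set 'rV[R]_n)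
    (w : 'I_n -> 'rV[R]_n -> 'rV[R]_n) : Prop :=
  (forall a, smooth_map_on U (w a)) /\
  (forall x, U x -> row_free (\matrix_a w a x)).

(* The symmetric matrix (g_ij) of g = sum_a (w^a)^2. *)
Definition coframe_metric (R : realType) (n : nat)
    (w : 'I_n -> 'rV[R]_n -> 'rV[R]_n) (x : 'rV[R]_n) : 'M[R]_n :=
  \matrix_(i, j) \sum_a w a x 0 i * w a x 0 j.

(* Gamma^k_ij
   = 1/2 sum_l g^kl (d_i g_jl + d_j g_il - d_l g_ij) *)
Definition christoffel (R : realType) (n : nat)
    (g : 'rV[R]_n -> 'M[R]_n) (k i j : 'I_n) (x : 'rV[R]_n) : R :=
  2%:R^-1 * \sum_l invmx (g x) k l *
    (partial i (fun y => g y j l) x + partial j (fun y => g y i l) x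
     - partial l (fun y => g y i j) x).

(* R^l_kij, i.e. R(d_i, d_j) d_k = sum_l R^l_kij d_l for the Levi-Civita
   connection of g. *)
Definition riemann (R : realType) (n : nat)
    (g : 'rV[R]_n -> 'M[R]_n) (l k i j : 'I_n) (x : 'rV[R]_n) : R :=
  partial i (christoffel g l j k) x - partial j (christoffel g l i k) x
  + \sum_m (christoffel g l i m x * christoffel g m j k x
            - christoffel g l j m x * christoffel g m i k x).

Definition flat_on (R : realType) (n : nat) (U : set 'rV[R]_n)
    (g : 'rV[R]_n -> 'M[R]_n) : Prop :=
  forall x, U x -> forall l k i j, riemann g l k i j x = 0.

(* [cparam] is meaningful only on the open set [cmap @` cdom]. *)
Record chart (R : realType) (n : nat) (T : topologicalType) := Chart {
  cdom : set T;
  cmap : T -> 'rV[R]_n;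
  cparam : 'rV[R]_n -> T;
  cdom_open : open cdom;
  cimage_open : open (cmap @` cdom);
  cmap_continuous : forall p, cdom p -> {for p, continuous cmap};
  cparam_continuous :
    forall x, (cmap @` cdom) x -> {for x, continuous cparam};
  cmapK : forall p, cdom p -> cparam (cmap p) = p
}.

Definition cimage (R : realType) (n : nat) (T : topologicalType)
    (c : chart R n T) : set 'rV[R]_n := cmap c @` cdom c.

Definition overlap (R : realType) (n : nat) (T : topologicalType)
    (c d : chart R n T) : set 'rV[R]_n := cmap c @` (cdom c `&` cdom d).

Definition transition (R : realType) (n : nat) (T : topologicalType)
    (c d : chart R n T) : 'rV[R]_n -> 'rV[R]_n := cmap d \o cparam c.

(* The smooth structure is given by an atlas that need not be maximal. *)
Record manifold (R : realType) (n : nat) := Manifold {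
  mcarrier :> topologicalType;
  mhausdorff : hausdorff_space mcarrier;
  msecond_countable : @second_countable mcarrier;
  mindex : Type;
  mchart : mindex -> chart R n mcarrier;
  mcover : forall p : mcarrier, exists a, cdom (mchart a) p;
  mcompat : forall a b,
    smooth_map_on (overlap (mchart a) (mchart b))
                  (transition (mchart a) (mchart b))
}.

(* A smooth 1-form on M: its coefficients in each chart of the atlas, where on
   overlaps the form in the first chart is the pullback, by the transition
   map, of the form in the second. *)
Record one_form (R : realType) (n : nat) (M : manifold R n) := OneForm {
  form_in :> mindex M -> 'rV[R]_n -> 'rV[R]_n;
  form_smooth : forall a, smooth_map_on (cimage (mchart a)) (form_in a);
  form_pullback : forall a b x, overlap (mchart a) (mchart b) x ->
    forall j, form_in a x 0 j =
      \sum_i form_in b (transition (mchart a) (mchart b) x) 0 i *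
        partial j (fun y => transition (mchart a) (mchart b) y 0 i) x
}.

Definition coframing (R : realType) (n : nat) (M : manifold R n)
    (w : 'I_n -> one_form M) : Prop :=
  forall a, coframing_on (cimage (mchart a)) (fun i => w i a).

Definition closed_form (R : realType) (n : nat) (M : manifold R n)
    (w : one_form M) : Prop :=
  forall a x, cimage (mchart a) x -> extd (w a) x = 0.

Definition flat_coframing (R : realType) (n : nat) (M : manifold R n)
    (w : 'I_n -> one_form M) : Prop :=
  forall a, flat_on (cimage (mchart a)) (coframe_metric (fun i => w i a)).

(* w /\ dw = 0 *)
Definition wedge_d_eq0 (R : realType) (n : nat) (M : manifold R n)
    (w : one_form M) : Prop :=
  forall a x, cimage (mchart a) x ->
    forall i j k, wedge12 (w a x) (extd (w a) x) i j k = 0.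

(* The value of dx^i, i.e. du^(i+1), at any point. *)
Definition dcoord (R : realType) (n : nat) (i : 'I_n) : 'rV[R]_n :=
  delta_mx 0 i.

(* u^1 du^2 /\ du^3 + u^2 du^3 /\ du^1 - 2 u^3 du^1 /\ du^2 *)
Definition Upsilon (R : realType) (u : 'rV[R]_3) : 'M[R]_3 :=
  u 0 0 *: wedge11 (dcoord R 1) (dcoord R 2%:R)
  + u 0 1 *: wedge11 (dcoord R 2%:R) (dcoord R 0)
  - (2%:R * u 0 2%:R) *: wedge11 (dcoord R 0) (dcoord R 1).

Definition Omega (R : realType) (i : 'I_3) (u : 'rV[R]_3) : 'M[R]_3 :=
  if i == 0 then Upsilon u else 0.

(* Main.v *)
Require Import Defs.
From HB Require Import structures.
From mathcomp Require Import all_boot all_order all_algebra.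
From mathcomp Require Import all_classical all_reals all_analysis.
From mathcomp Require Import ring lra.
Set Implicit Arguments.
Unset Strict Implicit.
Unset Printing Implicit Defensive.
Import Order.TTheory GRing.Theory Num.Theory.
Import numFieldNormedType.Exports.
Local Open Scope classical_set_scope.
Local Open Scope ring_scope.

(** Write nabla w^a = theta^a_b w^b with theta antisymmetric, and number the
    forms from 0.  Closedness of w^1 and w^2 makes theta^1 and theta^2
    symmetric in the frame, which together with antisymmetry leaves
      theta^1_2 = p w^0,  theta^1_0 = q w^0 + p w^2,
      theta^2_0 = r w^0 - p w^1,
    so that w^0 /\ dw^0 = 2 p w^0 /\ w^1 /\ w^2.  Flatness gives
    d theta^1_2 = theta^1_0 /\ theta^0_2; the wedge of this with w^0 is
    3 p^2 w^0 /\ w^1 /\ w^2 = 0, hence p = 0.  (This is O'Neill's formula for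
    the Riemannian submersion onto the plane with fibres along e_0.)
    In the second part, w^0 /\ Upsilon = 0 says that w^0 annihilates the vector
    field (u^1, u^2, -2 u^3); on each coordinate axis this kills one coefficient
    of w^0, so w^0 vanishes at the origin. *)

(** * Symmetry of second derivatives *)

Section SymmetryOfSecondDerivatives.
Variables (R : realType) (V : normedModType R).
Implicit Types (f : V -> R) (x y u v w : V) (s t : R).

Lemma is_derive_line f y u s : derivable f (y + s *: u) u ->
  is_derive s 1 (fun r => f (y + r *: u)) ('D_u f (y + s *: u)).
Proof.
move=> df.
have E : (fun h : R => h^-1 *:
      (((fun r => f (y + r *: u)) \o shift s) (h *: (1 : R)) - f (y + s *: u)))
   =
   (fun h : R => h^-1 *: ((f \o shift (y + s *: u)) (h *: u) - f (y + s *: u))).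
  apply/funext => h /=; congr (_ *: (f _ - _)).
  by rewrite scaler1 scalerDl addrCA.
by split; rewrite /derivable /derive E.
Qed.

Lemma is_derive_translate f w y u : derivable f (y + w) u ->
  is_derive y u (fun z => f (z + w)) ('D_u f (y + w)).
Proof.
move=> df.
have E : (fun h : R => h^-1 *: (((fun z => f (z + w)) \o shift y) (h *: u) -
     f (y + w))) =
   (fun h : R => h^-1 *: ((f \o shift (y + w)) (h *: u) - f (y + w))).
  by apply/funext => h /=; congr (_ *: (f _ - _)); rewrite addrA.
by split; rewrite /derivable /derive E.
Qed.

Lemma MVT_line f y u t : 0 < t ->
  (forall s, 0 <= s <= t -> derivable f (y + s *: u) u) ->
  exists2 c, 0 < c < t & f (y + t *: u) - f y = 'D_u f (y + c *: u) * t.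
Proof.
move=> t0 df.
have [s||c c0t] := @MVT R (fun s => f (y + s *: u))
    (fun s => 'D_u f (y + s *: u)) 0 t t0.
- rewrite in_itv /= => /andP[s0 st]; apply: is_derive_line.
  by apply: df; rewrite !ltW.
- apply: derivable_within_continuous => s; rewrite in_itv /= => s0t.
  by have [] := is_derive_line (df s s0t).
- rewrite scale0r addr0 subr0 => E; exists c => //.
Qed.

(** With F y = f (y + t v) - f y this is F (x + t u) - F x. It approximates t^2 times either mixed
    derivative and is symmetric in u and v. *)
Definition difference2 f x u v t : R :=
  f (x + t *: u + t *: v) - f (x + t *: u) - (f (x + t *: v) - f x).

Lemma difference2C f x u v t : difference2 f x u v t = difference2 f x v u t.
Proof.
rewrite /difference2 (addrAC x).
move: (f (_ + _ + _)) (f (x + t *: u)) (f (x + t *: v)) (f x) => p q r s; ring.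
Qed.

(** Two mean value theorems: along u for y |-> f (y + t v) - f y, then along v for 'D_u f. The value
    is exact, at some point of the parallelogram. *)
Lemma difference2_MVT f x u v t : 0 < t ->
  (forall a b, 0 <= a <= t -> 0 <= b <= t ->
     derivable f (x + a *: u + b *: v) u /\
     derivable ('D_u f) (x + a *: u + b *: v) v) ->
  exists a b, [/\ 0 < a < t, 0 < b < t &
    difference2 f x u v t = 'D_v ('D_u f) (x + a *: u + b *: v) * t * t].
Proof.
move=> t0 df.
have tt : 0 <= t <= t by rewrite lexx ltW.
have z0 : 0 <= (0 : R) <= t by rewrite lexx ltW.
have dF s : 0 <= s <= t -> is_derive (x + s *: u) u
    (fun y => f (y + t *: v) - f y)
    ('D_u f (x + s *: u + t *: v) - 'D_u f (x + s *: u)).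
  move=> st; apply: is_deriveB.
    by apply: is_derive_translate; have [+ _] := df s t st tt; exact.
  apply: derivableP; have [+ _] := df s 0 st z0.
  by rewrite scale0r addr0.
have [s st|a a0t E] := @MVT_line (fun y => f (y + t *: v) - f y) x u t t0.
  by have [] := dF s st.
have a0t' : 0 <= a <= t by case/andP: a0t => ? ?; rewrite !ltW.
move: E; rewrite (@derive_val _ _ _ _ _ _ _ (dF a a0t')) /difference2 => ->.
have [s st|b b0t ->] := @MVT_line ('D_u f) (x + a *: u) v t t0.
  by case: (df a s).
by exists a, b.
Qed.

Lemma dist_halves (a b z : R) :
  `|a - z| < `|a - b| / 2 -> `|b - z| < `|a - b| / 2 -> False.
Proof.
move=> az bz; have := ler_distD z a b; rewrite (distrC z) => /le_lt_trans.
by move=> /(_ _ (ltrD az bz)); rewrite -splitr ltxx.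
Qed.

(** Schwarz's theorem. The second difference over a small parallelogram equals t^2 times a value of
    each mixed derivative; by continuity both values stay within half the supposed gap of the values
    at x, which is impossible. *)
Lemma derive_comm (U : set V) f x u v : open U -> U x ->
  (forall y, U y -> derivable f y u) -> (forall y, U y -> derivable f y v) ->
  (forall y, U y -> derivable ('D_u f) y v) ->
  (forall y, U y -> derivable ('D_v f) y u) ->
  {for x, continuous ('D_v ('D_u f))} -> {for x, continuous ('D_u ('D_v f))} ->
  'D_v ('D_u f) x = 'D_u ('D_v f) x.
Proof.
move=> Uo Ux fu fv fuv fvu cuv cvu; apply/eqP/negPn/negP => neq.
set P : V -> R := 'D_v ('D_u f) in cuv neq *.
set Q : V -> R := 'D_u ('D_v f) in cvu neq *.
have e0 : 0 < `|P x - Q x| / 2 by rewrite divr_gt0// normr_gt0 subr_eq0.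
have PP : \forall y \near x, `|P x - P y| < `|P x - Q x| / 2.
  by move/cvgrPdist_lt : cuv => /(_ _ e0).
have QQ : \forall y \near x, `|Q x - Q y| < `|P x - Q x| / 2.
  by move/cvgrPdist_lt : cvu => /(_ _ e0).
have UU : \forall y \near x, U y by exact: open_nbhs_nbhs.
have /nbhs_ballP[d /= d0 H] : \forall y \near x, [/\ U y,
   `|P x - P y| < `|P x - Q x| / 2 & `|Q x - Q y| < `|P x - Q x| / 2].
  by move: UU PP QQ; apply: filterS3.
(* With t = d / m the parallelogram spanned by t u and t v lies in the ball of radius d; the summand
   1 makes m positive and the bound strict. *)
pose m := `|u| + `|v| + 1.
have m0 : 0 < m by rewrite ltr_wpDl// addr_ge0.
pose t := d / m.
have t0 : 0 < t by rewrite divr_gt0.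
have inb a b : 0 <= a <= t -> 0 <= b <= t -> ball x d (x + a *: u + b *: v).
  move=> /andP[a0 at_] /andP[b0 bt]; rewrite -ball_normE /=.
  rewrite -addrA opprD addNKr normrN (le_lt_trans (ler_normD _ _))//.
  rewrite !normrZ !ger0_norm//.
  have -> : d = t * m by rewrite /t divfK// gt_eqF.
  rewrite /m !mulrDr mulr1 ltr_pwDr// lerD// ler_wpM2r//.
have [|a [b [a0 b0 E1]]] := @difference2_MVT f x u v t t0.
  move=> a b ha hb; have [Uy _ _] := H _ (inb _ _ ha hb).
  by split; [exact: fu|exact: fuv].
have [|b' [a' [b'0 a'0 E2]]] := @difference2_MVT f x v u t t0.
  move=> b' a' hb ha; rewrite addrAC; have [Uy _ _] := H _ (inb _ _ ha hb).
  by split; [exact: fv|exact: fvu].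
have eqPQ (p q : R) : p * t * t = q * t * t -> p = q.
  by move=> /(mulIf (lt0r_neq0 t0)) /(mulIf (lt0r_neq0 t0)).
have E : P (x + a *: u + b *: v) = Q (x + a' *: u + b' *: v).
  rewrite -(addrAC x (b' *: v)); apply: eqPQ.
  exact: etrans (esym E1) (etrans (difference2C f x u v t) E2).
have W s : 0 < s < t -> 0 <= s <= t by case/andP => ? ?; rewrite !ltW.
have [_ HP _] := H _ (inb _ _ (W _ a0) (W _ b0)).
have [_ _ HQ] := H _ (inb _ _ (W _ a'0) (W _ b'0)).
by rewrite E in HP; exact: dist_halves HP HQ.
Qed.
End SymmetryOfSecondDerivatives.

(** * Derivatives of matrix-valued functions *)

Section DerivableBigops.
Variables (R : realType) (V : normedModType R) (x v : V).

Lemma derivable_bigsum (I : Type) (s : seq I) (P : pred I) (F : I -> V -> R) :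
  (forall i, derivable (F i) x v) ->
  derivable (fun y => \sum_(i <- s | P i) F i y) x v.
Proof.
move=> dF; elim: s => [|i s IH].
  by under eq_fun do rewrite big_nil; exact: derivable_cst.
under eq_fun do rewrite big_cons.
by case: (P i); [apply: derivableD; [exact: dF|exact: IH]|exact: IH].
Qed.

Lemma derivable_bigprod (I : Type) (s : seq I) (P : pred I) (F : I -> V -> R) :
  (forall i, derivable (F i) x v) ->
  derivable (fun y => \prod_(i <- s | P i) F i y) x v.
Proof.
move=> dF; elim: s => [|i s IH].
  by under eq_fun do rewrite big_nil; exact: derivable_cst.
under eq_fun do rewrite big_cons.
by case: (P i); [apply: derivableM; [exact: dF|exact: IH]|exact: IH].
Qed.

Lemma derive_bigsum (I : Type) (s : seq I) (F : I -> V -> R) :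
  (forall i, derivable (F i) x v) ->
  'D_v (fun y => \sum_(i <- s) F i y) x = \sum_(i <- s) 'D_v (F i) x.
Proof.
move=> dF; elim: s => [|i s IH].
  by under eq_fun do rewrite big_nil; rewrite big_nil derive_cst.
under eq_fun do rewrite big_cons.
by rewrite big_cons -IH -deriveD //; exact: derivable_bigsum.
Qed.

Lemma derivable_det n (A : V -> 'M[R]_n) :
  (forall i j, derivable (fun y => A y i j) x v) ->
  derivable (fun y => \det (A y)) x v.
Proof.
move=> dA; apply: derivable_bigsum => s; apply: derivableM.
  exact: derivable_cst.
exact: derivable_bigprod.
Qed.

(** Each entry is a cofactor over the determinant. Since [invmx] returns a singular matrix
    unchanged, the formula needs invertibility on a neighbourhood of x. *)
Lemma derivable_invmx n (A : V -> 'M[R]_n) i j :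
  (\forall y \near x, A y \in unitmx) ->
  (forall i j, derivable (fun y => A y i j) x v) ->
  derivable (fun y => invmx (A y) i j) x v.
Proof.
move=> uA dA.
have E : \forall y \near x,
    (\det (A y))^-1 * ((-1) ^+ (j + i) * \det (row' j (col' i (A y)))) =
    invmx (A y) i j.
  by near=> y; rewrite /invmx (near uA y)// !mxE.
apply: near_eq_derivable E _ => //; apply: derivableM.
  apply: derivableV; last exact: derivable_det.
  by rewrite -unitfE -unitmxE; exact: (nbhs_singleton uA).
apply: derivableM; first exact: derivable_cst.
by apply: derivable_det => k l; under eq_fun do rewrite !mxE; exact: dA.
Unshelve. all: by end_near. Qed.
End DerivableBigops.

(** * Entrywise partial derivatives of matrix products, transposes and inverses *)

Section MatrixCalculus.
Variables (R : realType) (n : nat).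
Implicit Types (U : set 'rV[R]_n) (x : 'rV[R]_n) (i : 'I_n).

Definition mxderivable p q i (F : 'rV[R]_n -> 'M[R]_(p, q)) x :=
  forall a b, derivable (fun y => F y a b) x (delta_mx 0 i).

Definition mxpartial p q i (F : 'rV[R]_n -> 'M[R]_(p, q)) x : 'M[R]_(p, q) :=
  \matrix_(a, b) partial i (fun y => F y a b) x.

Lemma mxderivable_mul p q r i (F : 'rV[R]_n -> 'M[R]_(p, q))
    (G : 'rV[R]_n -> 'M[R]_(q, r)) x :
  mxderivable i F x -> mxderivable i G x ->
  mxderivable i (fun y => F y *m G y) x.
Proof.
move=> dF dG a b; under eq_fun do rewrite mxE.
by apply: derivable_bigsum => k; exact: derivableM.
Qed.

Lemma mxpartial_mul p q r i (F : 'rV[R]_n -> 'M[R]_(p, q))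
    (G : 'rV[R]_n -> 'M[R]_(q, r)) x :
  mxderivable i F x -> mxderivable i G x ->
  mxpartial i (fun y => F y *m G y) x =
  mxpartial i F x *m G x + F x *m mxpartial i G x.
Proof.
move=> dF dG; apply/matrixP => a b; rewrite !mxE /partial -big_split /=.
under eq_fun do rewrite mxE.
rewrite derive_bigsum => [|k]; last exact: derivableM.
apply: eq_bigr => k _.
rewrite [LHS](@deriveM _ _ (fun y => F y a k) (fun y => G y k b)) //.
by rewrite !mxE addrC; congr (_ + _); exact: mulrC.
Qed.

Lemma mxderivable_sub p q i (F G : 'rV[R]_n -> 'M[R]_(p, q)) x :
  mxderivable i F x -> mxderivable i G x ->
  mxderivable i (fun y => F y - G y) x.
Proof.
move=> dF dG a b; under eq_fun do rewrite !mxE.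
exact: derivableB.
Qed.

Lemma mxderivable_add p q i (F G : 'rV[R]_n -> 'M[R]_(p, q)) x :
  mxderivable i F x -> mxderivable i G x ->
  mxderivable i (fun y => F y + G y) x.
Proof.
move=> dF dG a b; under eq_fun do rewrite !mxE.
exact: derivableD.
Qed.

Lemma mxpartial_sub p q i (F G : 'rV[R]_n -> 'M[R]_(p, q)) x :
  mxderivable i F x -> mxderivable i G x ->
  mxpartial i (fun y => F y - G y) x = mxpartial i F x - mxpartial i G x.
Proof.
move=> dF dG; apply/matrixP => a b; rewrite !mxE /partial.
under eq_fun do rewrite !mxE.
exact: deriveB.
Qed.

Lemma mxderivable_tr p q i (F : 'rV[R]_n -> 'M[R]_(p, q)) x :
  mxderivable i F x -> mxderivable i (fun y => (F y)^T) x.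
Proof. by move=> dF a b; under eq_fun do rewrite mxE; exact: dF. Qed.

Lemma mxpartial_tr p q i (F : 'rV[R]_n -> 'M[R]_(p, q)) x :
  mxpartial i (fun y => (F y)^T) x = (mxpartial i F x)^T.
Proof. by apply/matrixP => a b; rewrite !mxE; under eq_fun do rewrite mxE. Qed.

Lemma mxderivable_eq_on U p q i (F G : 'rV[R]_n -> 'M[R]_(p, q)) x :
  open U -> U x -> (forall y, U y -> F y = G y) ->
  mxderivable i F x -> mxderivable i G x.
Proof.
move=> Uo Ux FG dF a b; apply: near_eq_derivable (dF a b).
have : \forall y \near x, U y by exact: open_nbhs_nbhs.
by apply: filterS => y /FG ->.
Qed.

Lemma mxpartial_eq_on U p q i (F G : 'rV[R]_n -> 'M[R]_(p, q)) x :
  open U -> U x -> (forall y, U y -> F y = G y) ->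
  mxpartial i F x = mxpartial i G x.
Proof.
move=> Uo Ux FG; apply/matrixP => a b; rewrite !mxE; apply: near_eq_derive.
have : \forall y \near x, U y by exact: open_nbhs_nbhs.
by apply: filterS => y /FG ->.
Qed.

Lemma mxderivable_invmx U p i (F : 'rV[R]_n -> 'M[R]_p) x :
  open U -> U x -> (forall y, U y -> F y \in unitmx) ->
  mxderivable i F x -> mxderivable i (fun y => invmx (F y)) x.
Proof.
move=> Uo Ux uF dF a b; apply: derivable_invmx => //.
have : \forall y \near x, U y by exact: open_nbhs_nbhs.
exact: filterS.
Qed.
End MatrixCalculus.

(** * Levi-Civita connection and coframes *)

(** Vanishing curvature survives a change of frame W. Here Wi stands for d_i W, Tij for d_i T_j, Gij
    for d_i G_j, and D for the common value of both mixed derivatives of W. The sign of the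
    commutator flips because T is minus the gauge transform of G. *)
Lemma gauge_curvature (R : comUnitRingType) n
    (W D Wi Wj Ti Tj Tij Tji Gi Gj Gij Gji : 'M[R]_n) :
  W \in unitmx ->
  Gij - Gji + (Gi *m Gj - Gj *m Gi) = 0 ->
  Ti *m W = Wi - W *m Gi -> Tj *m W = Wj - W *m Gj ->
  Tij *m W + Tj *m Wi = D - (Wi *m Gj + W *m Gij) ->
  Tji *m W + Ti *m Wj = D - (Wj *m Gi + W *m Gji) ->
  Tij - Tji = Ti *m Tj - Tj *m Ti.
Proof.
move=> uW K /(canLR (subrK _)) <- /(canLR (subrK _)) <-.
move=> /(canRL (addrK _)) A /(canRL (addrK _)) B.
apply: (can_inj (mulmxK uW)); rewrite !mulmxBl A B.
have -> : Gij = Gji - (Gi *m Gj - Gj *m Gi).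
  by move/eqP: K; rewrite addr_eq0 subr_eq addrC => /eqP.
rewrite !mulmxBr !mulmxDl !mulmxDr !mulmxA.
(* Only a linear identity between these products remains, so they become atoms and [ring] works
   entry by entry. *)
move: (Ti *m W *m Gj) (Tj *m W *m Gi) (Ti *m Tj *m W) (Tj *m Ti *m W)
  (W *m Gi *m Gj) (W *m Gj *m Gi) (W *m Gji) => p1 p2 p3 p4 p5 p6 p7.
by apply/matrixP => a b; rewrite !mxE; ring.
Qed.

Lemma sub_subC (V : zmodType) (p q r s : V) :
  r = s -> p - q = (p - r) - (q - s).
Proof. by move=> ->; rewrite opprB addrA subrK. Qed.

Section LeviCivita.
Variables (R : realType) (n : nat) (g : 'rV[R]_n -> 'M[R]_n).
Hypothesis gT : forall x, (g x)^T = g x.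

(** The matrix of nabla along d_i: column m holds the components of nabla_(d_i) d_m. *)
Definition christoffel_mx (i : 'I_n) (x : 'rV[R]_n) : 'M[R]_n :=
  \matrix_(l, m) christoffel g l i m x.

(** An equality of functions rather than values, so that it rewrites under [partial]. *)
Lemma metric_entryC i j : (fun x => g x i j) = (fun x => g x j i).
Proof. by apply/funext => x; rewrite -[in LHS]gT mxE. Qed.

Lemma christoffelC k i j x : christoffel g k i j x = christoffel g k j i x.
Proof.
rewrite /christoffel; congr (_ * _); apply: eq_bigr => l _.
by rewrite (metric_entryC i j); congr (_ * (_ - _)); rewrite addrC.
Qed.

(** Lowering the index yields the Christoffel symbols of the first kind, free of the inverse
    metric. *)
Lemma mulmx_christoffel i x : g x \in unitmx ->
  g x *m christoffel_mx i x = \matrix_(l, j) (2^-1 *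
    (partial i (fun y => g y j l) x + partial j (fun y => g y i l) x
     - partial l (fun y => g y i j) x)).
Proof.
move=> ug; rewrite (_ : christoffel_mx i x = invmx (g x) *m
    \matrix_(l, j) (2^-1 *
    (partial i (fun y => g y j l) x + partial j (fun y => g y i l) x
     - partial l (fun y => g y i j) x))); first by rewrite mulKVmx.
apply/matrixP => l j; rewrite !mxE /christoffel mulr_sumr.
by apply: eq_bigr => m _; rewrite mxE mulrCA.
Qed.

(** This is nabla g = 0: adding the transpose of the first-kind symbols cancels every derivative of
    g except the one along d_i. *)
Lemma metric_compatible i x : g x \in unitmx ->
  mxpartial i g x = g x *m christoffel_mx i x + (g x *m christoffel_mx i x)^T.
Proof.
move=> ug; rewrite mulmx_christoffel//; apply/matrixP => l j; rewrite !mxE.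
rewrite (metric_entryC l j) (metric_entryC i l) (metric_entryC i j); lra.
Qed.

Lemma mxderivable_christoffel U i j x : open U -> U x ->
  (forall y, U y -> g y \in unitmx) ->
  mxderivable i g x ->
  (forall k, mxderivable i (mxpartial k g) x) ->
  mxderivable i (christoffel_mx j) x.
Proof.
move=> Uo Ux ug dg ddg l m; under eq_fun do rewrite mxE.
rewrite /christoffel.
have dE k a b : derivable (partial k (fun y => g y a b)) x (delta_mx 0 i).
  by have := ddg k a b; under eq_fun do rewrite mxE.
apply: derivableM; first exact: derivable_cst.
apply: derivable_bigsum => k; apply: derivableM.
  exact: (mxderivable_invmx Uo).
by apply: derivableB => //; apply: derivableD.
Qed.

Lemma riemann_mx i j x :
  (forall l k, riemann g l k i j x = 0) ->
  mxpartial i (christoffel_mx j) x - mxpartial j (christoffel_mx i) x +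
  (christoffel_mx i x *m christoffel_mx j x -
   christoffel_mx j x *m christoffel_mx i x) = 0.
Proof.
move=> R0; apply/matrixP => l k; rewrite mxE [RHS]mxE -(R0 l k) /riemann !mxE.
under [X in partial i X]eq_fun do rewrite mxE.
under [X in partial j X]eq_fun do rewrite mxE.
congr (_ + _); rewrite -sumrB; apply: eq_bigr => m _; by rewrite !mxE.
Qed.
End LeviCivita.

(** * Connection forms and structure equations of a coframe *)

Section Coframe.
Variables (R : realType) (n : nat) (U : set 'rV[R]_n).
Variable w : 'I_n -> 'rV[R]_n -> 'rV[R]_n.
Hypotheses (Uo : open U) (wU : coframing_on U w).

Definition coframe_mx (x : 'rV[R]_n) : 'M[R]_n := \matrix_a w a x.

Local Notation W := coframe_mx.
Local Notation g := (coframe_metric w).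
Local Notation Gamma := (christoffel_mx g).

Lemma coframe_metricE x : g x = (W x)^T *m W x.
Proof.
by apply/matrixP => i j; rewrite !mxE; apply: eq_bigr => a _; rewrite !mxE.
Qed.

Lemma coframe_metricT x : (g x)^T = g x.
Proof. by rewrite coframe_metricE trmx_mul trmxK. Qed.

Lemma coframe_unit x : U x -> W x \in unitmx.
Proof. by move=> Ux; rewrite -row_free_unit; exact: wU.2. Qed.

Lemma metric_unit x : U x -> g x \in unitmx.
Proof.
by move=> Ux; rewrite coframe_metricE unitmx_mul unitmx_tr coframe_unit.
Qed.

Lemma coframe_entry a b : (fun y => W y a b) = (fun y => w a y 0 b).
Proof. by apply/funext => y; rewrite mxE. Qed.

Lemma coframe_partial_entry i a b :
  (fun y => mxpartial i W y a b) = partial i (fun y => w a y 0 b).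
Proof. by apply/funext => y; rewrite mxE coframe_entry. Qed.

Lemma coframe_derivable i x : U x -> mxderivable i W x.
Proof.
move=> Ux a b; rewrite coframe_entry.
by have [_ /(_ i) [+ _]] := wU.1 a b 1%N; exact.
Qed.

Lemma coframe_partial_derivable i j x : U x -> mxderivable i (mxpartial j W) x.
Proof.
move=> Ux a b; rewrite coframe_partial_entry.
by have [_ /(_ j) [_ [_ /(_ i) [+ _]]]] := wU.1 a b 2%N; exact.
Qed.

Lemma coframe_partialC i j x : U x ->
  mxpartial i (mxpartial j W) x = mxpartial j (mxpartial i W) x.
Proof.
move=> Ux; apply/matrixP => a b.
rewrite [LHS]mxE [RHS]mxE.
rewrite (coframe_partial_entry i) (coframe_partial_entry j) /partial.
apply: (@derive_comm _ _ U (fun y => w a y 0 b)) => //.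
- by move=> y Uy; have := @coframe_derivable j y Uy a b; rewrite coframe_entry.
- by move=> y Uy; have := @coframe_derivable i y Uy a b; rewrite coframe_entry.
- by move=> y Uy; have := @coframe_partial_derivable i j y Uy a b;
    rewrite coframe_partial_entry.
- by move=> y Uy; have := @coframe_partial_derivable j i y Uy a b;
    rewrite coframe_partial_entry.
- by have [_ /(_ j) [_ [_ /(_ i) [_ [+ _]]]]] := wU.1 a b 2%N; exact.
- by have [_ /(_ i) [_ [_ /(_ j) [_ [+ _]]]]] := wU.1 a b 2%N; exact.
Qed.

Lemma metric_partialE i x : U x -> mxpartial i g x =
  (mxpartial i W x)^T *m W x + (W x)^T *m mxpartial i W x.
Proof.
move=> Ux; rewrite (mxpartial_eq_on i Uo Ux (fun y _ => coframe_metricE y)).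
rewrite mxpartial_mul ?mxpartial_tr//; last exact: coframe_derivable.
exact/mxderivable_tr/coframe_derivable.
Qed.

Lemma metric_derivable i x : U x -> mxderivable i g x.
Proof.
move=> Ux.
apply: (mxderivable_eq_on Uo Ux (fun y _ => esym (coframe_metricE y))).
apply: mxderivable_mul; last exact: coframe_derivable.
exact/mxderivable_tr/coframe_derivable.
Qed.

Lemma metric_partial_derivable i j x : U x -> mxderivable i (mxpartial j g) x.
Proof.
move=> Ux.
apply: (mxderivable_eq_on Uo Ux (fun y Uy => esym (metric_partialE j Uy))).
have dW := @coframe_derivable i x Ux.
have ddW := @coframe_partial_derivable i j x Ux.
apply: mxderivable_add; apply: mxderivable_mul.
- exact: mxderivable_tr ddW.
- exact: dW.
- exact: mxderivable_tr dW.
- exact: ddW.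
Qed.

Lemma christoffel_mx_derivable i j x : U x -> mxderivable i (Gamma j) x.
Proof.
move=> Ux; apply: (@mxderivable_christoffel _ _ _ U i j x Uo Ux).
- exact: metric_unit.
- exact: metric_derivable.
- by move=> k; exact: metric_partial_derivable.
Qed.

(* [connection_mx i x] has entries theta^a_b(d_i), where
   nabla w^a = sum_b theta^a_b w^b. *)
Definition connection_mx (i : 'I_n) (x : 'rV[R]_n) : 'M[R]_n :=
  (mxpartial i W x - W x *m Gamma i x) *m invmx (W x).

Local Notation theta := connection_mx.

Lemma connection_mxK i x : U x ->
  theta i x *m W x = mxpartial i W x - W x *m Gamma i x.
Proof. by move=> Ux; rewrite mulmxKV// coframe_unit. Qed.

(** The coframe is orthonormal. Comparing the product rule for g = W^T W with metric compatibility
    gives W^T (theta + theta^T) W = 0, and W is invertible. *)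
Lemma connection_mxT i x : U x -> (theta i x)^T = - theta i x.
Proof.
move=> Ux; have uW := coframe_unit Ux; apply/eqP; rewrite -addr_eq0; apply/eqP.
have E : (W x)^T *m (theta i x *m W x) + ((W x)^T *m (theta i x *m W x))^T = 0.
  rewrite connection_mxK// mulmxBr mulmxA -coframe_metricE.
  have := metric_compatible coframe_metricT i (metric_unit Ux).
  rewrite metric_partialE// => /eqP; rewrite -subr_eq0 => /eqP <-.
  by rewrite linearB /= trmx_mul trmxK addrACA opprD [_ + (_)^T *m _]addrC.
rewrite trmx_mul trmxK trmx_mul -mulmxA -mulmxDr -mulmxDl in E.
have /(congr1 (mulmx (invmx (W x)^T))) := E.
rewrite mulKmx ?unitmx_tr// mulmx0 => /(congr1 (mulmx^~ (invmx (W x)))).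
by rewrite mulmxK// mul0mx addrC.
Qed.

Lemma connection_mxN i a b x : U x -> theta i x a b = - theta i x b a.
Proof.
move=> Ux; have /matrixP /(_ b a) := connection_mxT i Ux.
by rewrite [LHS]mxE [RHS]mxE.
Qed.

Lemma connection_mx_derivable i j x : U x -> mxderivable i (theta j) x.
Proof.
move=> Ux; have dW := @coframe_derivable i x Ux.
apply: mxderivable_mul; last first.
  by apply: (mxderivable_invmx Uo Ux) => // y; exact: coframe_unit.
apply: mxderivable_sub; first exact: coframe_partial_derivable.
apply: mxderivable_mul; [exact: dW|exact: christoffel_mx_derivable].
Qed.

(** Differentiating theta_j W = d_j W - W Gamma_j, instead of the definition of theta_j, avoids
    computing the derivative of the inverse of W. *)
Lemma connection_partialE i j x : U x ->
  mxpartial i (theta j) x *m W x + theta j x *m mxpartial i W x =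
  mxpartial i (mxpartial j W) x -
  (mxpartial i W x *m Gamma j x + W x *m mxpartial i (Gamma j) x).
Proof.
move=> Ux; have dW := @coframe_derivable i x Ux.
have dth := @connection_mx_derivable i j x Ux.
have dG := @christoffel_mx_derivable i j x Ux.
rewrite -!mxpartial_mul// -mxpartial_sub.
- by apply: (mxpartial_eq_on i Uo Ux) => y Uy; exact: connection_mxK.
- exact: coframe_partial_derivable.
- exact: mxderivable_mul.
Qed.

(** Second structure equation with zero curvature: d theta = theta /\ theta. *)
Lemma flat_connection i j x : U x -> flat_on U g ->
  mxpartial i (theta j) x - mxpartial j (theta i) x =
  theta i x *m theta j x - theta j x *m theta i x.
Proof.
move=> Ux /(_ x Ux) R0.
have K := riemann_mx (fun l k => R0 l k i j).
(* Interchanging the mixed derivatives of W gives both differentiated equations the same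
   second-order term. *)
have B := connection_partialE j i Ux; rewrite (coframe_partialC j i Ux) in B.
apply: (gauge_curvature (coframe_unit Ux) K _ _ _ B).
- exact: connection_mxK.
- exact: connection_mxK.
- exact: connection_partialE.
Qed.

(** First structure equation, d w^a = sum_b theta^a_b /\ w^b: the Christoffel terms are symmetric in
    i and j and cancel. *)
Lemma torsion_free a i j x : U x ->
  extd (w a) x i j =
  (theta i x *m W x) a j - (theta j x *m W x) a i.
Proof.
move=> Ux.
have E k l : (theta k x *m W x) a l = partial k (fun y => w a y 0 l) x -
    \sum_m W x a m * christoffel g m k l x.
  transitivity ((mxpartial k W x - W x *m Gamma k x) a l).
    by congr (fun_of_matrix _ a l); exact: connection_mxK.
  rewrite mxE -(coframe_entry a l) [mxpartial _ _ _ _ _]mxE; congr (_ + _).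
  rewrite mxE mxE; congr (- _); apply: eq_bigr => m _.
  by congr (_ * _); exact: mxE.
apply: etrans (esym (congr2 (fun p q => p - q) (E i j) (E j i))).
rewrite [LHS]mxE; apply: sub_subC; apply: eq_bigr => m _; congr (_ * _).
exact: (christoffelC coframe_metricT).
Qed.
Lemma torsion_free_sum a i j x : U x ->
  extd (w a) x i j = \sum_b theta i x a b * w b x 0 j -
                     \sum_b theta j x a b * w b x 0 i.
Proof.
move=> Ux; rewrite torsion_free//.
have E k l : (theta k x *m W x) a l = \sum_b theta k x a b * w b x 0 l.
  rewrite [LHS]mxE; apply: eq_bigr => b _; congr (_ * _); exact: mxE.
exact: (congr2 (fun p q => p - q) (E i j) (E j i)).
Qed.

Lemma flat_connection_entry a c i j x : U x -> flat_on U g ->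
  partial i (fun y => theta j y a c) x - partial j (fun y => theta i y a c) x =
  \sum_b theta i x a b * theta j x b c - \sum_b theta j x a b * theta i x b c.
Proof.
move=> Ux fl; have /matrixP /(_ a c) := flat_connection i j Ux fl.
have subE (A B : 'M[R]_n) : (A - B) a c = A a c - B a c by rewrite !mxE.
rewrite !subE => E.
transitivity (mxpartial i (theta j) x a c - mxpartial j (theta i) x a c).
  by congr (_ - _); rewrite [RHS]mxE.
by rewrite E; congr (_ - _); rewrite [LHS]mxE.
Qed.

(* The columns of [invmx (W x)] are the vectors e_c of the dual frame:
   [frame_connection a x] has entries theta^a_b(e_c), at (c, b). *)
Definition row_connection (a : 'I_n) (x : 'rV[R]_n) : 'M[R]_n :=
  \matrix_(i, b) theta i x a b.

Definition frame_connection (a : 'I_n) (x : 'rV[R]_n) : 'M[R]_n :=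
  (invmx (W x))^T *m row_connection a x.

Lemma row_connectionE a x : U x ->
  row_connection a x = (W x)^T *m frame_connection a x.
Proof.
move=> Ux; rewrite /frame_connection mulmxA -trmx_mul.
by rewrite mulVmx ?coframe_unit// trmx1 mul1mx.
Qed.

Lemma connection_frameE a b i x : U x ->
  theta i x a b = \sum_c w c x 0 i * frame_connection a x c b.
Proof.
move=> Ux; have /matrixP /(_ i b) := row_connectionE a Ux.
by rewrite mxE => ->; rewrite mxE; apply: eq_bigr => c _; rewrite !mxE.
Qed.

Lemma frame_connectionN a b c x : U x ->
  frame_connection b x c a = - frame_connection a x c b.
Proof.
move=> Ux; rewrite !mxE -sumrN; apply: eq_bigr => i _.
rewrite -mulrN; congr (_ * _).
by rewrite [LHS]mxE [X in - X]mxE connection_mxN.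
Qed.

Lemma row_connection_mul a i j x :
  (row_connection a x *m W x) i j = (theta i x *m W x) a j.
Proof.
rewrite [LHS]mxE [RHS]mxE; apply: eq_bigr => k _.
by congr (_ * _); exact: mxE.
Qed.

(** When d w^a = 0, the first structure equation makes the coordinate components of nabla w^a
    symmetric; passing to the dual frame is a congruence by the inverse of W and preserves
    symmetry. *)
Lemma closed_frame_connectionT a x : U x -> extd (w a) x = 0 ->
  (frame_connection a x)^T = frame_connection a x.
Proof.
move=> Ux dw0; have uW := coframe_unit Ux.
have S : (row_connection a x *m W x)^T = row_connection a x *m W x.
  apply/matrixP => i j; rewrite mxE !row_connection_mul; apply/esym/eqP.
  by rewrite -subr_eq0 -torsion_free// dw0 mxE.
have E : frame_connection a x =
    (invmx (W x))^T *m (row_connection a x *m W x) *m invmx (W x).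
  by rewrite -mulmxA mulmxK.
by rewrite E trmx_mul trmx_mul S trmxK mulmxA.
Qed.

Lemma frame_connection_derivable a i x : U x ->
  mxderivable i (frame_connection a) x.
Proof.
move=> Ux; apply: mxderivable_mul.
  apply: mxderivable_tr; apply: (mxderivable_invmx Uo Ux).
    by move=> y; exact: coframe_unit.
  exact: coframe_derivable.
move=> j b; under eq_fun do rewrite mxE.
exact: connection_mx_derivable.
Qed.
End Coframe.

(** * Dimension three *)

Lemma sum_I3 (V : nmodType) (F : 'I_3 -> V) :
  \sum_(i < 3) F i = F 0 + F 1 + F 2%:R.
Proof.
rewrite !big_ord_recl big_ord0 addr0 addrA.
by congr (F _ + F _ + F _); apply/val_inj.
Qed.

(** The scalar triple product, that is, the coefficient of a /\ b /\ c. *)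
Definition triple (R : pzRingType) (a b c : 'I_3 -> R) : R :=
  a 0 * (b 1 * c 2%:R - b 2%:R * c 1) +
  a 1 * (b 2%:R * c 0 - b 0 * c 2%:R) +
  a 2%:R * (b 0 * c 1 - b 1 * c 0).

Lemma det_mx33 (R : comPzRingType) (A : 'M[R]_3) :
  \det A = triple (A 0) (A 1) (A 2%:R).
Proof.
have l0 : lift 0 (0 : 'I_2) = 1 :> 'I_3 by apply/val_inj.
have l1 : lift 0 (1 : 'I_2) = 2%:R :> 'I_3 by apply/val_inj.
have l2 : lift 1 (0 : 'I_2) = 0 :> 'I_3 by apply/val_inj.
have l3 : lift 1 (1 : 'I_2) = 2%:R :> 'I_3 by apply/val_inj.
have l4 : lift 2%:R (0 : 'I_2) = 0 :> 'I_3 by apply/val_inj.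
have l5 : lift 2%:R (1 : 'I_2) = 1 :> 'I_3 by apply/val_inj.
have det2 (B : 'M[R]_2) : \det B = B 0 0 * B 1 1 - B 0 1 * B 1 0.
  rewrite (expand_det_row _ 0) !big_ord_recl big_ord0 /cofactor !det_mx11 !mxE.
  rewrite (_ : lift 0 (0 : 'I_1) = 1 :> 'I_2); last exact/val_inj.
  rewrite (_ : lift 1 (0 : 'I_1) = 0 :> 'I_2); last exact/val_inj.
  by rewrite /=; ring.
rewrite (expand_det_row _ 0) sum_I3 /cofactor !det2 !mxE.
rewrite !(l0, l1, l2, l3, l4, l5).
by rewrite /= /triple; ring.
Qed.

(** At one point, a, b, c are the forms w^0, w^1, w^2, P is dp and d is d w^0. The hypotheses are
    the first structure equation for w^0 and the equation d(p w^0) = theta^1_0 /\ theta^0_2. *)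
Lemma structure_algebra (R : realDomainType) (a b c P : 'I_3 -> R) (p q r : R)
    (d : 'I_3 -> 'I_3 -> R) :
  triple a b c != 0 ->
  (forall i j, d i j =
     - (q * a i + p * c i) * b j - (r * a i - p * b i) * c j +
     (q * a j + p * c j) * b i + (r * a j - p * b j) * c i) ->
  (forall i j, P i * a j - P j * a i + p * d i j =
     - (q * a i + p * c i) * (r * a j - p * b j) +
     (q * a j + p * c j) * (r * a i - p * b i)) ->
  forall i j k, a i * d j k + a j * d k i + a k * d i j = 0.
Proof.
move=> abc dE H.
have p0 : p = 0.
  have E : 3 * p ^+ 2 * triple a b c = 0.
    (* This is the wedge of a with the difference of the two sides of [H]: dp drops out, p d
       contributes 2 p^2 and the right side another p^2. *)
    transitivity (
      a 2%:R * ((P 0 * a 1 - P 1 * a 0 + p * d 0 1) -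
        (- (q * a 0 + p * c 0) * (r * a 1 - p * b 1) +
         (q * a 1 + p * c 1) * (r * a 0 - p * b 0))) +
      a 0 * ((P 1 * a 2%:R - P 2%:R * a 1 + p * d 1 2%:R) -
        (- (q * a 1 + p * c 1) * (r * a 2%:R - p * b 2%:R) +
         (q * a 2%:R + p * c 2%:R) * (r * a 1 - p * b 1))) +
      a 1 * ((P 2%:R * a 0 - P 0 * a 2%:R + p * d 2%:R 0) -
        (- (q * a 2%:R + p * c 2%:R) * (r * a 0 - p * b 0) +
         (q * a 0 + p * c 0) * (r * a 2%:R - p * b 2%:R)))).
      by rewrite !dE /triple; ring.
    by rewrite !H !subrr !mulr0 !addr0.
  move/eqP: E; rewrite !mulf_eq0 (negPf abc) orbF orbb.
  by rewrite pnatr_eq0 => /eqP.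
(* With p = 0, d = - a /\ (q b + r c) is divisible by a. *)
by move=> i j k; rewrite !dE p0; ring.
Qed.

(** [th i a b] plays theta^a_b(d_i) and [dw i j] plays d_i of the j-th coefficient of w^0.
    Antisymmetry clears the diagonal, leaving only b = 0 in the sums for d theta^1_2. *)
Lemma structure_algebra_connection (R : realDomainType)
    (w : 'I_3 -> 'I_3 -> R) (th : 'I_3 -> 'I_3 -> 'I_3 -> R)
    (dp : 'I_3 -> R) (p q r : R) (dw d : 'I_3 -> 'I_3 -> R) :
  triple (w 0) (w 1) (w 2%:R) != 0 ->
  (forall i a b, th i a b = - th i b a) ->
  (forall i, th i 1 0 = q * w 0 i + p * w 2%:R i) ->
  (forall i, th i 2%:R 0 = r * w 0 i - p * w 1 i) ->
  (forall i j, d i j = dw i j - dw j i) ->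
  (forall i j, d i j =
     \sum_b th i 0 b * w b j - \sum_b th j 0 b * w b i) ->
  (forall i j, dp i * w 0 j + p * dw i j - (dp j * w 0 i + p * dw j i) =
     \sum_b th i 1 b * th j b 2%:R - \sum_b th j 1 b * th i b 2%:R) ->
  forall i j k, w 0 i * d j k + w 0 j * d k i + w 0 k * d i j = 0.
Proof.
move=> w0 thN th10 th20 dwE dE H.
have thD i a : th i a a = 0 by have := thN i a a; lra.
have th01 i : th i 0 1 = - (q * w 0 i + p * w 2%:R i) by rewrite thN th10.
have th02 i : th i 0 2%:R = - (r * w 0 i - p * w 1 i) by rewrite thN th20.
apply: (@structure_algebra R (w 0) (w 1) (w 2%:R) dp p q r) => // i j.
  rewrite dE !sum_I3 (thD i 0) (thD j 0) !th01 !th02; ring.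
have := H i j; rewrite !sum_I3 (thD i 1) (thD j 1) (thD i 2%:R) (thD j 2%:R).
by rewrite !th10 !th02 dwE => E; lra.
Qed.

(** The first part on an open set of R^3; it serves every chart of a manifold and also the
    neighbourhood of the origin in the second part. *)
Lemma flat_closed_wedge_d (R : realType) (U : set 'rV[R]_3)
    (w : 'I_3 -> 'rV[R]_3 -> 'rV[R]_3) :
  open U -> coframing_on U w ->
  (forall x, U x -> extd (w 1) x = 0) ->
  (forall x, U x -> extd (w 2%:R) x = 0) ->
  flat_on U (coframe_metric w) ->
  forall x, U x -> forall i j k, wedge12 (w 0 x) (extd (w 0) x) i j k = 0.
Proof.
move=> Uo wU dw1 dw2 flat x Ux.
pose T a := frame_connection w a.
have TN y a b c : U y -> T b y c a = - T a y c b.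
  exact: (frame_connectionN Uo wU).
have T1 y c b : U y -> T 1 y c b = T 1 y b c.
  move=> Uy.
  have /matrixP /(_ b c) := closed_frame_connectionT wU Uy (dw1 y Uy).
  by rewrite mxE.
have T2 y c b : U y -> T 2%:R y c b = T 2%:R y b c.
  move=> Uy.
  have /matrixP /(_ b c) := closed_frame_connectionT wU Uy (dw2 y Uy).
  by rewrite mxE.
have TD y a c : U y -> T a y c a = 0 by move=> Uy; have := TN y a a c Uy; lra.
(* Needed at every point of U, since it is differentiated below: symmetry and antisymmetry make
   theta^1_2 vanish on e_1 and e_2. *)
have th12 i y : U y -> connection_mx w i y 1 2%:R = T 1 y 0 2%:R * w 0 y 0 i.
  move=> Uy; rewrite (connection_frameE wU)// sum_I3 -/(T 1 y).
  have -> : T 1 y 1 2%:R = 0 by rewrite T1// TD.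
  have -> : T 1 y 2%:R 2%:R = 0.
    by rewrite (TN y 2%:R 1 2%:R)// T2// TD// oppr0.
  ring.
(* These are theta^1_2, theta^1_0 and theta^2_0 on e_0. The symmetries carry p to theta^1_0(e_2) and
   -p to theta^2_0(e_1). *)
pose p := T 1 x 0 2%:R; pose q := T 1 x 0 0; pose r := T 2%:R x 0 0.
have T10 : T 1 x 1 0 = 0 by rewrite T1// TD.
have T12 : T 1 x 2%:R 0 = p by rewrite T1.
have T20 : T 2%:R x 1 0 = - p by rewrite T2// (TN x 1 2%:R 0).
have T22 : T 2%:R x 2%:R 0 = 0 by rewrite T2// TD.
have th10 i : connection_mx w i x 1 0 = q * w 0 x 0 i + p * w 2%:R x 0 i.
  rewrite (connection_frameE wU)// sum_I3 -/(T 1 x) T10 T12 -/q; ring.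
have th20 i : connection_mx w i x 2%:R 0 = r * w 0 x 0 i - p * w 1 x 0 i.
  rewrite (connection_frameE wU)// sum_I3 -/(T 2%:R x) T20 T22 -/r; ring.
have thN i a b : connection_mx w i x a b = - connection_mx w i x b a.
  exact: (connection_mxN Uo wU).
have dth k l : partial k (fun y => connection_mx w l y 1 2%:R) x =
    partial k (fun y => T 1 y 0 2%:R) x * w 0 x 0 l +
    p * partial k (fun y => w 0 y 0 l) x.
  have dT := @frame_connection_derivable _ _ _ _ Uo wU 1 k x Ux 0 2%:R.
  have := @coframe_derivable _ _ _ _ wU k x Ux 0 l.
  rewrite coframe_entry => dw.
  transitivity (partial k (fun y => T 1 y 0 2%:R * w 0 y 0 l) x).
    apply: near_eq_derive.
    have : \forall y \near x, U y by exact: open_nbhs_nbhs.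
    by apply: filterS => y; exact: th12.
  rewrite /partial.
  apply: etrans (deriveM dT dw) _.
  by rewrite addrC; congr (_ + _); exact: mulrC.
apply: (@structure_algebra_connection R (fun a i => w a x 0 i)
  (fun i a b => connection_mx w i x a b)
  (fun i => partial i (fun y => T 1 y 0 2%:R) x) p q r
  (fun i j => partial i (fun y => w 0 y 0 j) x)) => //.
- have := coframe_unit wU Ux; rewrite unitmxE unitfE det_mx33 /triple !mxE.
  exact.
- by move=> i j; rewrite mxE.
- by move=> i j; exact: (torsion_free_sum wU).
- move=> i j; have := flat_connection_entry Uo wU 1 2%:R i j Ux flat.
  by rewrite (dth i j) (dth j i).
Qed.

(** * The obstruction at the origin *)

Lemma I3_cases (i : 'I_3) : [\/ i = 0, i = 1 | i = 2%:R].
Proof.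
by case: i => [[|[|[|//]]] ?]; [apply: Or31|apply: Or32|apply: Or33];
  apply/val_inj.
Qed.

(** If a coefficient of a were nonzero at 0, continuity would keep it nonzero at a nearby point of
    its axis other than 0, where the wedge is a nonzero multiple of it. *)
Lemma wedge_Upsilon_eq0 (R : realType) (U : set 'rV[R]_3)
    (a : 'rV[R]_3 -> 'rV[R]_3) :
  open U -> U 0 -> smooth_map_on U a ->
  (forall u, U u -> wedge12 (a u) (Upsilon u) 0 1 2%:R = 0) -> a 0 = 0.
Proof.
move=> Uo U0 sa H.
have E u : wedge12 (a u) (Upsilon u) 0 1 2%:R =
    a u 0 0 * u 0 0 + a u 0 1 * u 0 1 - 2%:R * a u 0 2%:R * u 0 2%:R.
  rewrite /wedge12 /Upsilon !mxE /=; ring.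
have key i : a 0 0 i = 0.
  apply/eqP/negPn/negP => ai0.
  have [/(_ 0 U0) ca _] := sa i 0%N.
  pose F (t : R) : 'rV[R]_3 := t *: delta_mx 0 i.
  have F0 : F t @[t --> (0:R)] --> (0 : 'rV[R]_3).
    rewrite -[X in _ --> X](scale0r (delta_mx 0 i)).
    exact: (@scalel_continuous _ _ (delta_mx 0 i) 0).
  have nP : \forall u \near (0 : 'rV[R]_3), U u /\ a u 0 i != 0.
    near=> u; split; near: u; first exact: open_nbhs_nbhs.
    exact: (cvgr_neq0 _ ca).
  have /nbhs_ballP[e /= e0 He] := F0 _ nP.
  (* The parameter e / 2 is nonzero and still inside the ball. *)
  have : ball (0 : R) e (e / 2).
    by rewrite -ball_normE /= sub0r normrN gtr0_norm ?divr_gt0//; lra.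
  move=> /He [UF]; rewrite -/(F (e / 2)) => aF0; move: (H _ UF); rewrite E.
  have FE j : F (e / 2) 0 j = (e / 2) * (j == i)%:R by rewrite !mxE.
  rewrite !FE => {}E; move: aF0 => /negP; apply.
  have {}e0 : e / 2 != 0 by rewrite gt_eqF// divr_gt0.
  move: E; case: (I3_cases i) => -> /=;
    rewrite ?mulr1 ?mulr0 ?addr0 ?add0r ?subr0.
  - by move/eqP; rewrite mulf_eq0 (negPf e0) orbF.
  - by move/eqP; rewrite mulf_eq0 (negPf e0) orbF.
  - move/eqP; rewrite oppr_eq0 mulf_eq0 (negPf e0) orbF mulf_eq0.
    by rewrite pnatr_eq0.
by apply/rowP => i; rewrite key mxE.
Unshelve. all: by end_near. Qed.

Theorem mainTheorem3 (R : realType) :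
  (forall (M : manifold R 3) (w : 'I_3 -> one_form M),
     coframing w ->
     closed_form (w 1) -> closed_form (w 2%:R) ->
     flat_coframing w ->
     wedge_d_eq0 (w 0)) /\
  ~ (exists (U : set 'rV[R]_3) (w : 'I_3 -> 'rV[R]_3 -> 'rV[R]_3),
       open U /\ U 0 /\
       coframing_on U w /\
       (forall (i : 'I_3) (u : 'rV[R]_3), U u -> extd (w i) u = Omega i u) /\
       flat_on U (coframe_metric w)).
Proof.
(* The first part is local: hypotheses and conclusion are read in each chart separately. *)
split=> [M w cow dw1 dw2 flat c x cx|[U [w [Uo [U0 [cow [dw flat]]]]]]].
  have cU : open (cimage (mchart c)) by exact: cimage_open.
  exact: (@flat_closed_wedge_d R _ (fun i => w i c) cU (cow c) (dw1 c) (dw2 c)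
    (flat c)).
have dw1 x : U x -> extd (w 1) x = 0 by move=> Ux; rewrite dw.
have dw2 x : U x -> extd (w 2%:R) x = 0 by move=> Ux; rewrite dw.
have w00 : w 0 0 = 0.
  apply: (wedge_Upsilon_eq0 Uo U0 (cow.1 0)) => u Uu.
  have := flat_closed_wedge_d Uo cow dw1 dw2 flat Uu 0 1 2%:R.
  by rewrite dw.
(* A zero row at the origin contradicts the invertibility of the coframe matrix there. *)
have := coframe_unit cow U0.
rewrite unitmxE unitfE det_mx33 /triple !mxE w00 !mxE.
by rewrite !mul0r !addr0 eqxx.
Qed.
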